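(* Let $I\subset\mathbb{C}[z_1,z_1^{-1},\ldots,z_r,z_r^{-1}]$ be an ideal and let $\mathbf{a}\in\mathbb{R}^r$. Then $\mathbf{a}\in\mathcal{A}_I$ if and only if $g\{\mathbf{a}\}$ is not lopsided for every $g\in I$. The same holds with ''lopsided'' replaced by ''superlopsided'': $\mathbf{a}\in\mathcal{A}_I$ if and only if $g\{\mathbf{a}\}$ is not superlopsided for every $g\in I$.
   Context: $\mathrm{Log}:(\mathbb{C}^* )^r\to\mathbb{R}^r$ is $\mathrm{Log}(z_1,\ldots,z_r)=(\log|z_1|,\ldots,\log|z_r|)$. The amoeba $\mathcal{A}_I$ is $\mathrm{Log}(V(I))$, where $V(I)\subset(\mathbb{C}^* )^r$ is the common zero locus of $I$. For a Laurent polynomial $g$ written as a sum of monomials $g=m_1+\cdots+m_s$ (nonzero coefficients, distinct exponent vectors) and $\mathbf{a}\in\mathbb{R}^r$, $g\{\mathbf{a}\}$ is the list of positive real numbers $\{|m_1(\mathbf{z})|,\ldots,|m_s(\mathbf{z})|\}$ for any $\mathbf{z}\in\mathrm{Log}^{-1}(\mathbf{a})$ (independent of the choice). A list of positive numbers is lopsided if one of the numbers is greater than the sum of all the others (an empty sum is $0$). A list of $s+1$ positive numbers is superlopsided if it has an entry $b_i$ with $b_i>s\,b_j$ for all $j\ne i$. The empty list (the case $g=0$) is neither lopsided nor superlopsided. *)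

(* Defs.v *)
From HB Require Import structures.
From mathcomp Require Import all_boot all_order all_algebra finmap.
From mathcomp Require Import monalg complex.
From mathcomp Require Import classical_sets reals sequences exp.

Set Implicit Arguments.
Unset Strict Implicit.
Unset Printing Implicit Defensive.

Import Order.TTheory GRing.Theory Num.Theory.
Local Open Scope ring_scope.
Local Open Scope classical_set_scope.

(* The Laurent polynomial ring C[z_1, 1/z_1, ..., z_r, 1/z_r] is the monoid   *)
(* algebra of the additive group Z^r. The ring structure of monalg.v asks     *)
(* for a monoid without nontrivial units, which Z^r is not, so only the       *)
(* module structure of {malg C[_]} is reused and the product is built here.   *)
Definition laurent (C : comNzRingType) (r : nat) : Type :=
  {malg C['rV[int]_r]}.

HB.instance Definition _ (C : comNzRingType) (r : nat) :=
  GRing.Lmodule.on (laurent C r).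

Section LaurentRing.
Local Open Scope fset_scope.
Local Open Scope ring_scope.
Variables (C : comNzRingType) (r : nat).
Implicit Types f g h : laurent C r.

Definition laurent_one : laurent C r := << 0 >>.

Definition laurent_mul f g : laurent C r :=
  \sum_(k <- msupp f) \sum_(l <- msupp g) << f@_k * g@_l *g k + l >>.

Lemma laurent_mulw (d1 d2 : {fset 'rV[int]_r}) f g :
    msupp f `<=` d1 -> msupp g `<=` d2 ->
  laurent_mul f g =
    \sum_(k <- d1) \sum_(l <- d2) << f@_k * g@_l *g k + l >>.
Proof.
move=> le1 le2; rewrite /laurent_mul (big_fset_incl _ le1) /=.
  apply/eq_bigr=> k _; apply/big_fset_incl => // l _ /mcoeff_outdom ->.
  by rewrite mulr0 monalgU0.
move=> k _ /mcoeff_outdom fk.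
by rewrite big1 => // l _; rewrite fk mul0r monalgU0.
Qed.

Lemma laurent_mulC : commutative laurent_mul.
Proof.
move=> f g; rewrite /laurent_mul exchange_big /=.
apply: eq_bigr => k _; apply: eq_bigr => l _.
by rewrite mulrC addrC.
Qed.

Lemma laurent_mulUU c d k l :
  laurent_mul << c *g k >> << d *g l >> = << c * d *g k + l >>.
Proof.
by rewrite (laurent_mulw msuppU_le msuppU_le) !big_seq_fset1 !mcoeffUU.
Qed.

Lemma laurent_mulDl : left_distributive laurent_mul +%R.
Proof.
move=> f1 f2 g; have le_g := fsubset_refl (msupp g).
rewrite (laurent_mulw (msuppD_le f1 f2) le_g).
rewrite (laurent_mulw (fsubsetUl _ (msupp f2)) le_g).
rewrite (laurent_mulw (fsubsetUr (msupp f1) _) le_g).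
rewrite -big_split /=; apply/eq_bigr=> k _.
rewrite -big_split /=; apply/eq_bigr=> l _.
by rewrite mcoeffD mulrDl monalgUD.
Qed.

Lemma laurent_mul0l : left_zero 0 laurent_mul.
Proof. by move=> g; rewrite /laurent_mul msupp0 big_seq_fset0. Qed.

Lemma laurent_mul_suml (J : Type) (s : seq J) (F : J -> laurent C r) g :
  laurent_mul (\sum_(j <- s) F j) g = \sum_(j <- s) laurent_mul (F j) g.
Proof.
exact: (big_morph (laurent_mul^~ g) (fun _ _ => laurent_mulDl _ _ _)
  (laurent_mul0l g)).
Qed.

Lemma laurent_mul_sumr (J : Type) (s : seq J) (F : J -> laurent C r) g :
  laurent_mul g (\sum_(j <- s) F j) = \sum_(j <- s) laurent_mul g (F j).
Proof.
rewrite laurent_mulC laurent_mul_suml.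
by apply: eq_bigr => j _; rewrite laurent_mulC.
Qed.

Lemma laurent_mulA : associative laurent_mul.
Proof.
move=> f g h.
rewrite [f]monalgE !(laurent_mul_suml (msupp f)); apply: eq_bigr => k _.
rewrite [g]monalgE !(laurent_mul_suml (msupp g), laurent_mul_sumr (msupp g)).
apply: eq_bigr => l _.
rewrite [h]monalgE !(laurent_mul_sumr (msupp h)); apply: eq_bigr => m _.
by rewrite !laurent_mulUU mulrA addrA.
Qed.

Lemma laurent_mul1l : left_id laurent_one laurent_mul.
Proof.
move=> g; rewrite [g]monalgE laurent_mul_sumr.
by apply: eq_bigr => k _; rewrite laurent_mulUU mul1r add0r.
Qed.

Lemma laurent_one_neq0 : laurent_one != 0.
Proof. by rewrite /laurent_one monalgU_eq0 oner_neq0. Qed.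

HB.instance Definition _ := GRing.Zmodule_isComNzRing.Build (laurent C r)
  laurent_mulA laurent_mulC laurent_mul1l laurent_mulDl laurent_one_neq0.

End LaurentRing.

(* Unlike the ideals of ring_quotient.v, ideals need not be proper.           *)
Definition is_ideal (A : comNzRingType) (I : set A) : Prop :=
  [/\ I 0,
      forall f g, I f -> I g -> I (f + g)
    & forall f g, I g -> I (f * g)].

Section Amoeba.
Variables (R : realType) (r : nat).
Implicit Types (g : laurent R[i] r) (z : 'rV[R[i]]_r) (k : 'rV[int]_r).
Implicit Types (a : 'rV[R]_r) (I : set (laurent R[i] r)).

Definition torus : set 'rV[R[i]]_r := [set z | forall i, z 0 i != 0].

Definition monomial_eval z k : R[i] := \prod_(i < r) z 0 i ^ k 0 i.

Definition laurent_eval g z : R[i] :=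
  \sum_(k <- msupp g) g@_k * monomial_eval z k.

Definition zero_locus I : set 'rV[R[i]]_r :=
  [set z | torus z /\ forall g, I g -> laurent_eval g z = 0].

Definition Log z : 'rV[R]_r := \row_i ln (Normc.normc (z 0 i)).

Definition amoeba I : set 'rV[R]_r := (Log @` zero_locus I)%classic.

Definition term_moduli g z : seq R :=
  [seq Normc.normc (g@_k * monomial_eval z k) | k <- msupp g].

Definition real_point a : 'rV[R[i]]_r := \row_i (expR (a 0 i))%:C%C.

(* The list g{a}, computed at the point of the fibre of Log over a with       *)
(* positive real coordinates; by term_moduli_fibre any other point of the     *)
(* fibre gives the same list.                                                 *)
Definition moduli_at g a : seq R := term_moduli g (real_point a).

Lemma torus_real_point a : torus (real_point a).
Proof.
move=> i; rewrite mxE; apply/eqP => -[] /eqP.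
by rewrite gt_eqF // expR_gt0.
Qed.

Lemma normc_real_point a i : Normc.normc (real_point a 0 i) = expR (a 0 i).
Proof.
by rewrite mxE /= expr0n /= addr0 sqrtr_sqr ger0_norm // expR_ge0.
Qed.

Lemma Log_real_point a : Log (real_point a) = a.
Proof.
by apply/rowP => i; rewrite mxE normc_real_point expRK.
Qed.

Lemma normc_gt0 (x : R[i]) : x != 0 -> 0 < Normc.normc x.
Proof.
move=> x0; rewrite lt0r; apply/andP; split.
  by apply: contraNneq x0 => /Normc.eq0_normc ->.
by case: x x0 => u v _; exact: sqrtr_ge0.
Qed.

Lemma normc_exprz (x : R[i]) (n : int) :
  Normc.normc (x ^ n) = Normc.normc x ^ n.
Proof.
have normcX m : Normc.normc (x ^+ m) = Normc.normc x ^+ m.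
  elim: m => [|m IH]; first by rewrite !expr0 Normc.normc1.
  by rewrite !exprS Normc.normcM IH.
case: n => n; first exact: normcX.
by rewrite !NegzE -!exprnN Normc.normcV normcX.
Qed.

Lemma term_moduli_fibre g z w :
  torus z -> torus w -> Log z = Log w -> term_moduli g z = term_moduli g w.
Proof.
move=> tz tw /rowP eqLog; apply: eq_map => k; rewrite !Normc.normcM.
congr (_ * _); rewrite /monomial_eval.
rewrite !(big_morph (@Normc.normc R) (@Normc.normcM R) (@Normc.normc1 R)).
apply: eq_bigr => i _; rewrite !normc_exprz; congr (_ ^ _).
have := eqLog i; rewrite !mxE; apply: ln_inj;
  by rewrite posrE normc_gt0.
Qed.

End Amoeba.

Definition lopsided (R : realType) (s : seq R) : bool :=
  [exists i : 'I_(size s), \sum_(j < size s | j != i) s`_j < s`_i].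

(* A list of n + 1 entries is compared with the factor n = (size s).-1.       *)
Definition superlopsided (R : realType) (s : seq R) : bool :=
  [exists i : 'I_(size s), [forall j : 'I_(size s),
     (j != i) ==> ((size s).-1%:R * s`_j < s`_i)]].

(* Main.v *)
Require Import Defs.
From mathcomp Require Import all_boot all_order all_algebra finmap.
From mathcomp Require Import monalg complex.
From mathcomp Require Import classical_sets reals sequences exp.
From mathcomp Require Import boolp topology normedtype derive trigo.
From mathcomp Require Import ring lra zify.

(* If a lies outside the amoeba, the torus T = Log^-1(a) misses V(I); by      *)
(* compactness finitely many f in I have no common zero on T. On T complex    *)
(* conjugation sends values of Laurent polynomials to values of Laurent       *)
(* polynomials, so g = sum f^* f lies in I and is positive on T. After        *)
(* scaling by the maximum of g, u = 1 - g / max satisfies |u| <= rho < 1 on   *)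
(* T, and 1 - u^n is in I. By the Cauchy estimates every term of u^n has      *)
(* modulus at most rho^n at a, whereas u^n has at most (2nd + 1)^r terms:     *)
(* for large n the constant term of 1 - u^n dominates superlopsidedly.        *)

Set Implicit Arguments.
Unset Strict Implicit.
Unset Printing Implicit Defensive.

Import Order.TTheory GRing.Theory Num.Theory.
Import numFieldNormedType.Exports.
Local Open Scope ring_scope.

(** A zero of [I] over [a] makes the terms of every [g] in [I] cancel, so by the triangle inequality
    no term outweighs the sum of the others ([amoeba_not_lopsided]). Superlopsided lists of positive
    numbers are lopsided ([superlopsided_lopsided]), so both converses follow from one construction,
    [exists_superlopsided], for [a] outside the amoeba. Compactness of the fibre yields an element
    of [I] that is positive on it ([ideal_positive_on_fibre]). Rescaling turns this element into
    [1 - u] with [u] of modulus at most some [rho < 1] there ([ideal_contraction]). In [1 - u ^+ n]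
    the terms coming from [u ^+ n] decay geometrically ([coeff_le_sup]), while their number grows
    only polynomially in [n] ([size_msupp_box]), so the constant term eventually wins
    ([polynomial_geometric_lt1]). *)

(** * Exponents occurring in products and powers *)

Section LaurentRing.
Variables (C : comNzRingType) (r : nat).
Implicit Types f g : laurent C r.

Lemma laurent_mcoeffM_neq0 f g k : (f * g)@_k != 0 ->
  exists l, exists m, [/\ l \in msupp f, m \in msupp g & k = l + m].
Proof.
have -> : f * g = laurent_mul f g by [].
rewrite /laurent_mul raddf_sum /= => nz.
have [l lf /= nzl] : exists2 l, l \in msupp f &
   (\sum_(m <- msupp g) << f@_l * g@_m *g l + m >>)@_k != 0.
  apply: contrapT => no; case/negP: nz; apply/eqP.
  rewrite big_seq big1 // => l lf; apply/eqP; apply: contrapT => /negP ?.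
  by apply: no; exists l.
move: nzl; rewrite raddf_sum /= => nzl.
have [m mg /= nzm] : exists2 m, m \in msupp g &
   (<< f@_l * g@_m *g l + m >>)@_k != 0.
  apply: contrapT => no; case/negP: nzl; apply/eqP.
  rewrite big_seq big1 // => m mg; apply/eqP; apply: contrapT => /negP ?.
  by apply: no; exists m.
exists l, m; split=> //.
move: nzm; rewrite mcoeffU; case: (l + m =P k) => [-> //|_].
by rewrite mulr0n eqxx.
Qed.

(** Box sizes add under products, so the box of a power grows linearly; this controls both the
    number of terms and the grid size in the Cauchy estimate. *)
Definition laurent_in_box (d : nat) f :=
  forall k i, f@_k != 0 -> (`|k 0%R i| <= d)%N.

Lemma laurent_in_boxX d f n :
  laurent_in_box d f -> laurent_in_box (n * d) (f ^+ n).
Proof.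
move=> fd; elim: n => [|n IH] k i.
  rewrite expr0 -[1]/(laurent_one C r) /laurent_one mcoeffU.
  by case: (0 =P k) => [<-|_]; rewrite ?mxE // mulr0n eqxx.
rewrite exprS => /laurent_mcoeffM_neq0 [l [m [lf mf ->]]].
rewrite mxE -lez_nat mulSn PoszD abszE (le_trans (ler_normD _ _)) //.
by rewrite -!abszE lerD // lez_nat; [apply: fd|apply: IH]; rewrite mcoeff_neq0.
Qed.

Lemma exists_laurent_box f : exists d, laurent_in_box d f.
Proof.
exists (\sum_(k <- msupp f) \sum_(i < r) `|k 0%R i|)%N => k i.
rewrite mcoeff_neq0 => kf.
rewrite (big_fsetD1 k kf) /= (bigD1 i) //=.
by rewrite -addnA leq_addr.
Qed.

End LaurentRing.

(** * Evaluation at a torus point as a ring morphism *)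

Section LaurentEval.
Variables (R : realType) (r : nat) (z : 'rV[R[i]]_r).
Hypothesis tz : torus z.
Implicit Types f g : laurent R[i] r.

Lemma monomial_evalD k l :
  monomial_eval z (k + l) = monomial_eval z k * monomial_eval z l.
Proof.
rewrite /monomial_eval -big_split; apply: eq_bigr => i _.
by rewrite mxE expfzDr // tz.
Qed.

Lemma monomial_eval0 : monomial_eval z 0 = 1.
Proof. by rewrite /monomial_eval big1 // => i _; rewrite mxE expr0z. Qed.

Lemma monomial_eval_neq0 k : monomial_eval z k != 0.
Proof. by apply/prodf_neq0 => i _; rewrite expfz_neq0 // tz. Qed.

(** [laurent_eval] unfolds to the generic [mmap] with the identity on coefficients, which supplies
    its additive properties. *)
Lemma laurent_evalU c k : laurent_eval << c *g k >> z = c * monomial_eval z k.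
Proof. exact: (@mmapU _ _ _ idfun (monomial_eval z) c k). Qed.

Lemma laurent_eval0 : laurent_eval (0 : laurent R[i] r) z = 0.
Proof. exact: (@mmap0 _ _ _ idfun (monomial_eval z)). Qed.

Lemma laurent_eval1 : laurent_eval 1 z = 1.
Proof.
have -> : 1 = << 0 >> :> laurent R[i] r by [].
by rewrite laurent_evalU monomial_eval0 mulr1.
Qed.

Lemma laurent_evalD f g :
  laurent_eval (f + g) z = laurent_eval f z + laurent_eval g z.
Proof. exact: (@mmapD _ _ _ idfun (monomial_eval z) f g). Qed.

Lemma laurent_evalB f g :
  laurent_eval (f - g) z = laurent_eval f z - laurent_eval g z.
Proof. exact: (@mmapB _ _ _ idfun (monomial_eval z) f g). Qed.

Lemma laurent_eval_sum (J : Type) (s : seq J) (F : J -> laurent R[i] r) :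
  laurent_eval (\sum_(j <- s) F j) z = \sum_(j <- s) laurent_eval (F j) z.
Proof.
exact: (big_morph (fun f => laurent_eval f z) laurent_evalD laurent_eval0).
Qed.

Lemma laurent_evalM f g :
  laurent_eval (f * g) z = laurent_eval f z * laurent_eval g z.
Proof.
have -> : f * g = laurent_mul f g by [].
rewrite /laurent_mul laurent_eval_sum mulr_suml; apply: eq_bigr => k _.
rewrite laurent_eval_sum mulr_sumr; apply: eq_bigr => l _.
by rewrite laurent_evalU monomial_evalD mulrACA.
Qed.

Lemma laurent_evalX f n : laurent_eval (f ^+ n) z = laurent_eval f z ^+ n.
Proof.
by elim: n => [|n IH]; rewrite ?expr0 ?laurent_eval1 // !exprS laurent_evalM IH.
Qed.

End LaurentEval.

(** * Lopsided and superlopsided lists *)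

Section Lopsided.
Variable R : realType.

Lemma le_normc_sum (J : Type) (s : seq J) (P : pred J) (F : J -> R[i]) :
  Normc.normc (\sum_(j <- s | P j) F j)
    <= \sum_(j <- s | P j) Normc.normc (F j).
Proof.
elim/big_rec2: _ => [|j x y _ IH]; first by rewrite Normc.normc0.
by rewrite (le_trans (le_normcD _ _)) // lerD2l.
Qed.

(** Each entry is minus the sum of the others, so the triangle inequality bounds its modulus. *)
Lemma lopsided_sum_neq0 (t : seq R[i]) :
  \sum_(x <- t) x = 0 -> ~~ lopsided [seq Normc.normc x | x <- t].
Proof.
move=> t0; set s := map _ _; apply/existsP; case=> i; apply/negP.
rewrite -leNgt.
have szE : size s = size t by rewrite size_map.
have nthE (j : 'I_(size s)) : s`_j = Normc.normc t`_j.
  by rewrite (nth_map 0) // -szE.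
rewrite nthE; under eq_bigr do rewrite nthE.
move: t0; rewrite (big_nth 0) -szE big_mkord (bigD1 i) //= => /eqP.
by rewrite addr_eq0 => /eqP ->; rewrite normcN le_normc_sum.
Qed.

(** With [n] other entries, summing [n * s_j < s_i] over them gives [n] times the lopsided
    inequality. For [n = 0] the sum is empty and positivity of the single entry is what is
    needed. *)
Lemma superlopsided_lopsided (s : seq R) :
  (forall x, x \in s -> 0 < x) -> superlopsided s -> lopsided s.
Proof.
move=> s_gt0 /existsP[i /forallP big_i]; apply/existsP; exists i.
case: (posnP (size s).-1) => [s1|n_gt0].
  rewrite big1 ?s_gt0 ?mem_nth // => j ji.
  case/negP: ji; apply/eqP/val_inj => /=.
  have ord0E (k : 'I_(size s)) : k = 0 :> nat.
    apply/eqP; rewrite -leqn0 -[0%N]s1 -ltnS.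
    by rewrite (leq_trans (ltn_ord k)) ?leqSpred.
  by rewrite !ord0E.
have constE : \sum_(j < size s | j != i) s`_i = s`_i *+ (size s).-1.
  by rewrite sumr_const cardC1 card_ord.
rewrite -(ltr_pM2l (_ : 0 < (size s).-1%:R)) ?ltr0n // mulr_sumr.
rewrite mulr_natl -constE.
apply: ltr_sum => [|j ji]; last exact: (implyP (big_i j)).
have : (0 < #|predC1 i|)%N by rewrite cardC1 card_ord.
by case/card_gt0P => j ji; apply/hasP; exists j; rewrite ?mem_index_enum.
Qed.

Lemma superlopsided_moduli r (g : laurent R[i] r) (z : 'rV[R[i]]_r) k0 :
  k0 \in msupp g ->
  (forall k, k \in msupp g -> k != k0 ->
    (size (msupp g)).-1%:R * Normc.normc (g@_k * monomial_eval z k)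
      < Normc.normc (g@_k0 * monomial_eval z k0)) ->
  superlopsided (term_moduli g z).
Proof.
move=> k0g big_k0; apply/existsP.
have szE : size (term_moduli g z) = size (msupp g) by rewrite size_map.
have lti : (index k0 (msupp g) < size (term_moduli g z))%N.
  by rewrite szE index_mem.
exists (Ordinal lti); apply/forallP => j; apply/implyP.
have ltj : (j < size (msupp g))%N by rewrite -szE.
rewrite -val_eqE /= => /= ; move: {j} (nat_of_ord j) ltj => j ltj ji.
rewrite szE /term_moduli !(nth_map 0) ?index_mem // nth_index //.
apply: big_k0; first exact: mem_nth.
by apply: contraNneq ji => <-; rewrite index_uniq.
Qed.

End Lopsided.

(** * The complex exponential and sums over roots of unity *)

Section Cis.
Variable R : realType.

Definition cis (x : R) : R[i] := (cos x +i* sin x)%C.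

Lemma cis0 : cis 0 = 1.
Proof. by rewrite /cis cos0 sin0. Qed.

Lemma cisD x y : cis (x + y) = cis x * cis y.
Proof.
apply/eqP; rewrite eq_complex /= cosD sinD eqxx /=; apply/eqP.
by rewrite addrC.
Qed.

Lemma normc_cis x : Normc.normc (cis x) = 1.
Proof. by rewrite /= cos2Dsin2 sqrtr1. Qed.

Lemma cis_neq0 x : cis x != 0.
Proof.
by apply/eqP => c0; have := normc_cis x; rewrite c0 Normc.normc0; apply/eqP;
  rewrite eq_sym oner_eq0.
Qed.

Lemma cisN x : cis (- x) = (cis x)^-1.
Proof.
by apply: (mulfI (cis_neq0 x)); rewrite -cisD subrr cis0 divff ?cis_neq0.
Qed.

Lemma cis_natM n x : cis (n%:R * x) = cis x ^+ n.
Proof.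
elim: n => [|n IH]; first by rewrite mul0r cis0 expr0.
by rewrite -[n.+1%:R]natr1 mulrDl mul1r cisD IH exprSr.
Qed.

Lemma cis_intM (n : int) x : cis (n%:~R * x) = cis x ^ n.
Proof.
case: n => n; first exact: cis_natM.
by rewrite NegzE mulrNz mulNr cisN cis_natM -exprnN.
Qed.

Lemma cis_sum (J : Type) (s : seq J) (F : J -> R) :
  cis (\sum_(j <- s) F j) = \prod_(j <- s) cis (F j).
Proof. exact: (big_morph cis cisD cis0). Qed.

Lemma cis2pi : cis (pi *+ 2) = 1.
Proof. by rewrite /cis cos2pi sin2pi. Qed.

(** By the half-angle formula, [cos x = 1] would force [sin (x / 2) = 0], yet [x / 2] lies strictly
    between [0] and [pi]. *)
Lemma cis_neq1 x : 0 < x < pi *+ 2 -> cis x != 1.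
Proof.
move=> /andP[x0 x2]; apply/eqP => -[c1 _].
have s0 : 0 < sin (x / 2).
  by apply: sin_gt0_pi; rewrite divr_gt0 //= ltr_pdivrMr // mulr_natr.
have xE : x = (x / 2) *+ 2 by rewrite -mulr_natr divfK ?pnatr_eq0.
move: c1; rewrite xE cos_mulr2n.
rewrite -[cos _ ^+ 2](addrK (sin (x / 2) ^+ 2)) cos2Dsin2 => c1.
have : sin (x / 2) ^+ 2 = 0 by lra.
by move/eqP; rewrite expf_eq0 /= gt_eqF.
Qed.

(** Orthogonality of characters of Z/N; the bound on [d] makes the character trivial only for
    [d = 0]. *)
Lemma sum_cis_grid (N : nat) (d : int) : (`|d| < N)%N ->
  \sum_(j < N) cis (d%:~R * (pi *+ 2 * j%:R / N%:R)) = (N%:R *+ (d == 0)).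
Proof.
move=> dN; have N0 : N%:R != 0 :> R by rewrite pnatr_eq0; case: N dN.
have [->|d0] := eqVneq.
  under eq_bigr do rewrite mul0r cis0.
  by rewrite sumr_const card_ord.
rewrite mulr0n; pose y : R := pi *+ 2 / N%:R.
have yE (j : 'I_N) :
    cis (d%:~R * (pi *+ 2 * j%:R / N%:R)) = cis (d%:~R * y) ^+ j.
  by rewrite -cis_natM /y; congr cis; ring.
under eq_bigr do rewrite yE.
have y1 : cis (d%:~R * y) != 1.
  wlog d_gt0 : d d0 dN {yE} / 0 < d.
    move=> gt0; case: (ltrgtP d 0) (d0) => // d_lt _; last exact: gt0.
    have := gt0 (- d); rewrite oppr_eq0 d0 oppr_gt0 d_lt abszN.
    move=> /(_ isT dN isT).
    by rewrite mulrNz mulNr cisN invr_eq1.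
  apply: cis_neq1; rewrite /y; case: d d_gt0 {d0} dN => // d d0 dN.
  have NR : 0 < N%:R :> R by rewrite ltr0n; case: N dN {N0 y}.
  have pi2_gt0 : 0 < pi *+ 2 :> R by rewrite pmulrn_lgt0 // pi_gt0.
  apply/andP; split; first by rewrite mulr_gt0 ?divr_gt0 // ltr0z.
  by rewrite mulrA ltr_pdivrMr // mulrC ltr_pM2l // ltr_nat.
(* The geometric sum times its ratio minus [1] is the [N]-th power of the ratio minus [1], which
   vanishes. *)
apply: (mulfI (_ : cis (d%:~R * y) - 1 != 0)); first by rewrite subr_eq0.
rewrite -subrX1 mulr0 -cis_natM /y.
have -> : N%:R * (d%:~R * (pi *+ 2 / N%:R)) = d%:~R * (pi *+ 2) :> R by field.
by rewrite cis_intM cis2pi exp1rz subrr.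
Qed.

End Cis.

(** * The fibre of [Log] over [a] and the Cauchy estimate *)

Section Fibre.
Variables (R : realType) (r : nat) (a : 'rV[R]_r).
Implicit Types (t : 'rV[R]_r) (k : 'rV[int]_r) (g : laurent R[i] r).

Definition fibre_pt t : 'rV[R[i]]_r :=
  \row_i ((expR (a 0 i))%:C%C * cis (t 0 i)).

Definition phase k t : R := \sum_(i < r) (k 0 i)%:~R * t 0 i.

Lemma torus_fibre_pt t : torus (fibre_pt t).
Proof.
move=> i; rewrite mxE mulf_neq0 ?cis_neq0 //.
by have := torus_real_point a i; rewrite mxE.
Qed.

Lemma Log_fibre_pt t : Log (fibre_pt t) = a.
Proof.
apply/rowP => i; rewrite !mxE Normc.normcM normc_cis mulr1.
by have := normc_real_point a i; rewrite mxE => ->; rewrite expRK.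
Qed.

(** The common modulus of the monomial with exponent [k] on the whole fibre. *)
Definition weight k : R := \prod_(i < r) expR (a 0 i) ^ k 0 i.

Lemma weight_gt0 k : 0 < weight k.
Proof. by apply: prodr_gt0 => i _; rewrite exprz_gt0 // expR_gt0. Qed.

Lemma weightN k : weight (- k) = (weight k)^-1.
Proof.
rewrite /weight -prodfV; apply: eq_bigr => i _.
by rewrite mxE -invr_expz.
Qed.

Lemma monomial_real_point k : monomial_eval (real_point a) k = (weight k)%:C%C.
Proof.
rewrite rmorph_prod; apply: eq_bigr => i _.
by rewrite mxE; apply/esym/rmorphXz; rewrite unitfE gt_eqF ?expR_gt0.
Qed.

Lemma monomial_fibre_pt t k :
  monomial_eval (fibre_pt t) k = (weight k)%:C%C * cis (phase k t).
Proof.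
rewrite -monomial_real_point cis_sum -big_split; apply: eq_bigr => i _.
by rewrite !mxE cis_intM expfzMl.
Qed.

Lemma normcR (x : R) : Normc.normc x%:C%C = `|x|.
Proof. by rewrite /= expr0n addr0 sqrtr_sqr. Qed.

Lemma moduli_weight g k :
  Normc.normc (g@_k * monomial_eval (real_point a) k)
    = Normc.normc g@_k * weight k.
Proof.
by rewrite monomial_real_point Normc.normcM normcR ger0_norm // ltW ?weight_gt0.
Qed.

Lemma phaseDl k l t : phase (k + l) t = phase k t + phase l t.
Proof.
rewrite /phase -big_split; apply: eq_bigr => i _.
by rewrite mxE intrD mulrDl.
Qed.

Lemma phaseNl k t : phase (- k) t = - phase k t.
Proof.
by rewrite /phase -sumrN; apply: eq_bigr => i _; rewrite mxE mulrNz mulNr.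
Qed.

(** Angles of the [N]-torsion points of the compact torus. *)
Definition grid_pt N (j : {ffun 'I_r -> 'I_N}) : 'rV[R]_r :=
  \row_i (pi *+ 2 * (j i)%:R / N%:R).

Lemma sum_cis_phase_grid N k : (forall i, (`|k 0%R i| < N)%N) ->
  \sum_(j : {ffun 'I_r -> 'I_N}) cis (phase k (grid_pt j))
    = (N ^ r)%:R *+ (k == 0).
Proof.
move=> kN; under eq_bigr => j _ do (rewrite cis_sum;
  under eq_bigr => i _ do rewrite mxE).
rewrite -(bigA_distr_bigA (fun i (j : 'I_N) =>
  cis ((k 0 i)%:~R * (pi *+ 2 * j%:R / N%:R)))).
under eq_bigr => i _ do rewrite sum_cis_grid //.
have [->|k0] := eqVneq.
  under eq_bigr do rewrite mxE eqxx mulr1n.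
  by rewrite prodr_const card_ord natrX.
have [i ki] : exists i, k 0 i != 0 by apply/rV0Pn.
by rewrite (bigD1 i) //= (negPf ki) mulr0n mul0r.
Qed.

Lemma grid_pt_bound N (j : {ffun 'I_r -> 'I_N}) i :
  0 <= grid_pt j 0 i <= pi *+ 2.
Proof.
have N0 : (0 < N)%N := leq_ltn_trans (leq0n _) (ltn_ord (j i)).
have pi2_gt0 : 0 < pi *+ 2 :> R by rewrite pmulrn_lgt0 // pi_gt0.
rewrite mxE divr_ge0 ?mulr_ge0 ?(ltW pi2_gt0) //=.
by rewrite ler_pdivrMr ?ltr0n // ler_pM2l // ler_nat ltnW.
Qed.

(* The Cauchy estimate, by averaging over a fine enough finite subgroup of    *)
(* the torus instead of integrating.                                          *)
Lemma coeff_le_sup g (B : R) :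
    (forall t, (forall i, 0 <= t 0 i <= pi *+ 2) ->
      Normc.normc (laurent_eval g (fibre_pt t)) <= B) ->
  forall k, Normc.normc g@_k * weight k <= B.
Proof.
move=> gB k.
have [d gd] := exists_laurent_box g.
(* Large enough that no exponent [l] of [g] other than [k] is congruent to [k] modulo [N], so
   averaging over the grid isolates the coefficient at [k] exactly. *)
pose N := (d + \sum_(i < r) `|k 0%R i|).+1.
have kN l i : l \in msupp g -> (`|(l - k)%R 0%R i| < N)%N.
  rewrite -mcoeff_neq0 => /gd ld; rewrite ltnS -lez_nat PoszD abszE !mxE.
  rewrite (le_trans (ler_normB _ _)) // lerD // -abszE lez_nat ?ld //.
  by rewrite (bigD1 i) //= leq_addr.
have NE : \sum_(j : {ffun 'I_r -> 'I_N})
    laurent_eval g (fibre_pt (grid_pt j)) * cis (- phase k (grid_pt j))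
    = (N ^ r)%:R * (g@_k * (weight k)%:C%C).
  under eq_bigr do rewrite mulr_suml.
  rewrite exchange_big /=.
  (* Written as a sum over the support, the coefficient matches the left side term by term, whether
     or not [k] is in the support. *)
  have -> : g@_k = \sum_(l <- msupp g) g@_l *+ (l - k == 0).
    have [kg|kg] := boolP (k \in msupp g).
      rewrite (big_fsetD1 k kg) /= subrr eqxx big_seq big1 ?addr0 // => l.
      by rewrite in_fsetD1 subr_eq0 => /andP[/negPf ->].
    rewrite (mcoeff_outdom kg) big_seq big1 // => l lg.
    by rewrite subr_eq0; case: eqP kg => // <-; rewrite lg.
  rewrite mulr_suml mulr_sumr [LHS]big_seq [RHS]big_seq.
  apply: eq_bigr => l lg.
  under eq_bigr => j _.
    rewrite monomial_fibre_pt -!mulrA -cisD -phaseNl -phaseDl; over.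
  rewrite -!mulr_sumr sum_cis_phase_grid; last by move=> i; exact: kN.
  by case: (l - k =P 0) => [/subr0_eq ->|_]; rewrite ?mulr1n ?mulr0n; ring.
have N_gt0 : 0 < (N ^ r)%:R :> R by rewrite ltr0n expn_gt0.
rewrite -(ler_pM2l N_gt0).
have -> : (N ^ r)%:R * (Normc.normc g@_k * weight k)
    = Normc.normc ((N ^ r)%:R * (g@_k * (weight k)%:C%C)).
  rewrite !Normc.normcM normcR (gtr0_norm (weight_gt0 k)) -mulr_natl.
  by rewrite normcMn Normc.normc1 mulr_natl.
rewrite -NE (le_trans (le_normc_sum _ _ _)) //.
have -> : (N ^ r)%:R * B = \sum_(j : {ffun 'I_r -> 'I_N}) B.
  by rewrite sumr_const card_ffun !card_ord mulr_natl.
apply: ler_sum => j _; rewrite Normc.normcM normc_cis mulr1 gB //.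
exact: grid_pt_bound.
Qed.

End Fibre.

(** * An element of the ideal that is positive on the fibre *)

Section Positivity.
Variables (R : realType) (r : nat) (a : 'rV[R]_r).
Implicit Types (t : 'rV[R]_r) (f g : laurent R[i] r).

(* On the fibre of Log over a, conj z_i = e^(2 a_i) / z_i, so complex         *)
(* conjugation acts on the values of Laurent polynomials.                     *)
Definition laurent_conj f : laurent R[i] r :=
  \sum_(k <- msupp f) << (f@_k)^*%C * (weight a k ^+ 2)%:C%C *g - k >>.

Lemma laurent_eval_conj f t :
  laurent_eval (laurent_conj f) (fibre_pt a t)
    = ((laurent_eval f (fibre_pt a t))^*)%C.
Proof.
rewrite laurent_eval_sum /laurent_eval rmorph_sum; apply: eq_bigr => k _.
rewrite -/(laurent_eval _ _) laurent_evalU !monomial_fibre_pt.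
have conjE (x : R[i]) (w p : R) :
    ((x * (w%:C * cis p))^* = x^* * (w%:C * cis (- p)))%C.
  case: x => u v; apply/eqP; rewrite eq_complex /= cosN sinN.
  by apply/andP; split; apply/eqP; ring.
apply: etrans (esym (conjE _ _ _)).
rewrite phaseNl weightN -mulrA; congr (_ * _).
rewrite mulrA -rmorphM; congr (_%:C%C * _).
by rewrite expr2 mulfK // gt_eqF ?weight_gt0.
Qed.

Lemma mul_conjc_normc (x : R[i]) : (x^*)%C * x = (Normc.normc x ^+ 2)%:C%C.
Proof.
case: x => u v; apply/eqP; rewrite eq_complex /= sqr_sqrtr; last first.
  by rewrite addr_ge0 ?sqr_ge0.
by apply/andP; split; apply/eqP; ring.
Qed.

Lemma continuous_sum (T : topologicalType) (J : Type) (s : seq J)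
    (F : J -> T -> R) :
  (forall j, continuous (F j)) -> continuous (fun x => \sum_(j <- s) F j x).
Proof.
by move=> cF; apply: continuous_big => //; exact: add_continuous.
Qed.

Lemma continuous_phase k : continuous (phase k : 'rV[R]_r -> R).
Proof.
apply: continuous_sum => i t.
apply: continuousM; [exact: cst_continuous|exact: coord_continuous].
Qed.

(** Squaring removes the square root: the squared modulus is a polynomial in sines and cosines of
    the phases, with [u] and [v] the real and imaginary parts of the terms. *)
Lemma continuous_normc_laurent_eval f :
  continuous (fun t => Normc.normc (laurent_eval f (fibre_pt a t)) ^+ 2).
Proof.
pose u k t := complex.Re f@_k * weight a k * cos (phase k t)
              + - (complex.Im f@_k * weight a k) * sin (phase k t).
pose v k t := complex.Re f@_k * weight a k * sin (phase k t)
              + complex.Im f@_k * weight a k * cos (phase k t).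
have evE t : laurent_eval f (fibre_pt a t)
    = ((\sum_(k <- msupp f) u k t) +i* (\sum_(k <- msupp f) v k t))%C.
  rewrite /laurent_eval; elim: (enum_fset _) => [|k s IH].
    by rewrite !big_nil.
  rewrite !big_cons IH monomial_fibre_pt; apply/eqP.
  rewrite eq_complex /u /v; case: (f@_k) => x y /=.
  by apply/andP; split; apply/eqP; ring.
have -> : (fun t => Normc.normc (laurent_eval f (fibre_pt a t)) ^+ 2)
    = (fun t => (\sum_(k <- msupp f) u k t) ^+ 2
              + (\sum_(k <- msupp f) v k t) ^+ 2).
  by apply/funext => t; rewrite evE /= sqr_sqrtr // addr_ge0 ?sqr_ge0.
have ccos k : continuous (fun t => cos (phase k t)).
  move=> t; apply: (continuous_comp (@continuous_phase k t)).
  exact: continuous_cos.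
have csin k : continuous (fun t => sin (phase k t)).
  move=> t; apply: (continuous_comp (@continuous_phase k t)).
  exact: continuous_sin.
have cM (h1 h2 : 'rV[R]_r -> R) :
    continuous h1 -> continuous h2 -> continuous (fun t => h1 t * h2 t).
  by move=> c1 c2 t; exact: (continuousM (c1 t) (c2 t)).
have cD (h1 h2 : 'rV[R]_r -> R) :
    continuous h1 -> continuous h2 -> continuous (fun t => h1 t + h2 t).
  by move=> c1 c2 t; exact: (continuousD (c1 t) (c2 t)).
have cc c (h : 'rV[R]_r -> R) : continuous h -> continuous (fun t => c * h t).
  by apply: cM => t; exact: cst_continuous.
have cu : continuous (fun t => \sum_(k <- msupp f) u k t).
  by apply: continuous_sum => k; exact: cD (cc _ _ (ccos k)) (cc _ _ (csin k)).
have cv : continuous (fun t => \sum_(k <- msupp f) v k t).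
  by apply: continuous_sum => k; exact: cD (cc _ _ (csin k)) (cc _ _ (ccos k)).
exact: cD (cM _ _ cu cu) (cM _ _ cv cv).
Qed.

Definition angle_box : set 'rV[R]_r :=
  [set t | forall i, `[0, pi *+ 2]%classic (t ord0 i)].

Lemma compact_angle_box : compact angle_box.
Proof.
apply: (@rV_compact R r (fun=> `[0, pi *+ 2]%classic)) => _.
exact: segment_compact.
Qed.

Lemma ideal_sum (A : comNzRingType) (I : set A) (J : eqType) (s : seq J)
    (F : J -> A) :
  is_ideal I -> (forall j, j \in s -> I (F j)) -> I (\sum_(j <- s) F j).
Proof.
move=> [I0 ID _] IF; rewrite big_seq.
by elim/big_ind: _ => // j /IF.
Qed.

(** The open sets where some [f] in [I] is nonzero cover the compact angle box. For a finite
    subcover [D], the sum of [laurent_conj f * f] takes the value of the sum of the squared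
    moduli. *)
Lemma ideal_positive_on_fibre (I : set (laurent R[i] r)) :
    is_ideal I -> ~ amoeba I a ->
  exists g (h : 'rV[R]_r -> R), [/\ I g, continuous h,
    forall t, laurent_eval g (fibre_pt a t) = (h t)%:C%C &
    forall t, angle_box t -> 0 < h t].
Proof.
move=> idealI aI.
pose h f t := Normc.normc (laurent_eval f (fibre_pt a t)) ^+ 2.
have h_ge0 f t : 0 <= h f t by rewrite sqr_ge0.
have [D DI Dcover] : finite_subset_cover I
    (fun f => [set t | 0 < h f t]%classic) angle_box.
  have := compact_angle_box; rewrite compact_cover; apply.
    move=> f _; apply: (open_comp _ (@open_gt R 0)) => t _.
    exact: continuous_normc_laurent_eval.
  (* A point of the fibre where all of [I] vanishes would put [a] in the amoeba. *)
  move=> t _; apply: contrapT => no; apply: aI.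
  exists (fibre_pt a t); last exact: Log_fibre_pt.
  split; first exact: torus_fibre_pt.
  move=> f If; apply: contrapT => f0; apply: no; exists f => //=.
  by rewrite exprn_gt0 // normc_gt0 //; apply/eqP.
exists (\sum_(f <- D) laurent_conj f * f), (fun t => \sum_(f <- D) h f t).
split.
- apply: ideal_sum => // f /DI; rewrite inE => If.
  by case: idealI => _ _; apply.
- by apply: continuous_sum => f; exact: continuous_normc_laurent_eval.
- move=> t; rewrite laurent_eval_sum rmorph_sum; apply: eq_bigr => f _.
  rewrite laurent_evalM ?laurent_eval_conj ?mul_conjc_normc //.
  exact: torus_fibre_pt.
- move=> t /Dcover[f /= fD ft]; rewrite (big_fsetD1 f fD) /=.
  by rewrite ltr_pwDl // sumr_ge0.
Qed.

End Positivity.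

(** * Geometric decay against the polynomial number of terms *)

Section Growth.
Variable R : realType.

Lemma bernoulli_ineq (x : R) m : 0 <= x -> 1 + m%:R * x <= (1 + x) ^+ m.
Proof.
move=> x0; elim: m => [|m IH]; first by rewrite mul0r addr0 expr0.
rewrite exprS; have := ler_wpM2l (_ : 0 <= 1 + x) IH.
move/(_ (addr_ge0 ler01 x0)); apply: le_trans.
have : 0 <= m%:R * (x * x) by rewrite !mulr_ge0.
rewrite -natr1; lra.
Qed.

(** Take [n = m * r.+1]. The polynomial factor is at most [C * m ^ r], while Bernoulli's inequality
    raised to the power [r.+1] bounds [rho ^ (- n)] below by [(m * x) ^ r.+1]; the extra factor [m]
    wins once [m] exceeds [C / x ^ r.+1]. *)
Lemma polynomial_geometric_lt1 (rho : R) (d r : nat) : 0 <= rho < 1 ->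
  exists n, 2 * ((n * d).*2.+1 ^ r)%:R * rho ^+ n < 1.
Proof.
move=> /andP[]; rewrite le_eqVlt => /predU1P[<- _|rho0 rho1].
  by exists 1; rewrite expr1 mulr0.
pose x := rho^-1 - 1.
have x0 : 0 < x by rewrite subr_gt0 invf_gt1.
pose C : R := 2 * ((r.+1 * d).*2.+1 ^ r)%:R.
have C0 : 0 <= C / x ^+ r.+1.
  by rewrite divr_ge0 ?mulr_ge0 ?exprn_ge0 // ltW.
have := archi_boundP C0; set m := Num.Def.archi_bound _ => Cm.
have m0 : (0 < m)%N by rewrite -(ltr0n R) (le_lt_trans C0).
exists (m * r.+1)%N.
have le1 : 2 * ((m * r.+1 * d).*2.+1 ^ r)%:R <= C * m%:R ^+ r.
  rewrite /C -mulrA ler_pM2l // !natrX -exprMn lerXn2r ?nnegrE ?mulr_ge0 //.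
  by rewrite -natrM ler_nat; nia.
have xm : m%:R * x < (rho^-1) ^+ m.
  have := bernoulli_ineq m (ltW x0); rewrite [1 + x]addrC subrK.
  apply: lt_le_trans.
  by rewrite ltrDr.
rewrite exprM (le_lt_trans (ler_wpM2r _ le1)) ?exprn_ge0 ?(ltW rho0) //.
have rm0 : 0 < (rho ^+ m) ^+ r.+1 by rewrite !exprn_gt0.
rewrite -ltr_pdivlMr // div1r -!exprVn.
have : (m%:R * x) ^+ r.+1 < (rho^-1 ^+ m) ^+ r.+1.
  by rewrite ltr_pXn2r ?nnegrE ?mulr_ge0 ?exprn_ge0 ?invr_ge0 ?(ltW x0)
    ?(ltW rho0).
apply: le_lt_trans; rewrite exprMn exprS mulrAC ler_pM2r ?exprn_gt0 ?ltr0n //.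
by rewrite -ler_pdivrMr ?exprn_gt0 // ltW.
Qed.

End Growth.

Lemma size_msupp_box (C : comNzRingType) r d (f : laurent C r) :
  laurent_in_box d f -> (size (msupp f) <= d.*2.+1 ^ r)%N.
Proof.
move=> fd.
(* Shifting by [d] moves each coordinate from [[-d, d]] into [[0, 2d]], so [inord] loses nothing on
   the support. *)
pose F (k : 'rV[int]_r) : {ffun 'I_r -> 'I_d.*2.+1} :=
  [ffun i => inord `|(k 0 i + d%:Z)%R|].
have shiftI (x y : int) : (`|x| <= d)%N -> (`|y| <= d)%N ->
    inord `|(x + d%:Z)%R| = inord `|(y + d%:Z)%R| :> 'I_d.*2.+1 -> x = y.
  by move=> xd yd /(congr1 val) /=; rewrite !inordK; lia.
have Fi : {in msupp f &, injective F}.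
  move=> k l; rewrite -!mcoeff_neq0 => /fd kd /fd ld /ffunP Fkl.
  apply/rowP => i; have := Fkl i; rewrite !ffunE.
  exact: shiftI (kd i) (ld i).
rewrite -(size_map F) -[X in (_ <= X ^ _)%N]card_ord.
rewrite -[r in (_ ^ r)%N]card_ord -card_ffun.
rewrite -(card_uniqP _) ?max_card // map_inj_in_uniq //; exact: fset_uniq.
Qed.

(** * The two directions of the equivalence *)

Section Nullstellensatz.
Variables (R : realType) (r : nat) (a : 'rV[R]_r) (I : set (laurent R[i] r)).
Hypothesis idealI : is_ideal I.

Lemma term_moduli_gt0 (g : laurent R[i] r) z (x : R) :
  torus z -> x \in term_moduli g z -> 0 < x.
Proof.
move=> tz /mapP[k]; rewrite -mcoeff_neq0 => gk ->.
by rewrite normc_gt0 // mulf_neq0 // monomial_eval_neq0.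
Qed.

(** The moduli may be computed at any point of the fibre, in particular at a zero of [I], where the
    terms of [g] sum to zero. *)
Lemma amoeba_not_lopsided g : amoeba I a -> I g -> ~~ lopsided (moduli_at g a).
Proof.
move=> [z [tz z0] zE] Ig.
have -> : moduli_at g a = term_moduli g z.
  apply: term_moduli_fibre => //; first exact: torus_real_point.
  by rewrite Log_real_point.
have -> : term_moduli g z
    = [seq Normc.normc x | x <- [seq g@_k * monomial_eval z k | k <- msupp g]].
  by rewrite -map_comp.
by apply: lopsided_sum_neq0; rewrite big_map -[RHS](z0 g Ig).
Qed.

Lemma laurent_coeff1 k : (1 : laurent R[i] r)@_k = (k == 0)%:R.
Proof.
have -> : 1 = << 0 >> :> laurent R[i] r by [].
by rewrite mcoeffU eq_sym.
Qed.

Lemma ideal_contraction : ~ amoeba I a ->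
  exists (u : laurent R[i] r) (rho : R), [/\ I (1 - u), 0 <= rho < 1 &
    forall t, angle_box t ->
      Normc.normc (laurent_eval u (fibre_pt a t)) <= rho].
Proof.
move=> aI; have [g [h [Ig ch gE h_gt0]]] := ideal_positive_on_fibre idealI aI.
have box0 : (@angle_box R r !=set0)%classic.
  exists 0 => i /=; rewrite mxE in_itv /= lexx.
  by rewrite mulrn_wge0 // ltW // pi_gt0.
have ch_box := continuous_subspaceT (A := @angle_box R r) ch.
have [t0] := compact_EVT_min box0 (@compact_angle_box R r) ch_box.
rewrite inE => t0b h_min.
have [t1] := compact_EVT_max box0 (@compact_angle_box R r) ch_box.
rewrite inE => t1b h_max.
have M0 := h_gt0 _ t1b.
(* With [h t0] and [h t1] the minimum and maximum on the box, the values [1 - h t / h t1] lie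
   between [0] and [rho = 1 - h t0 / h t1], and [rho < 1] because the minimum is positive. *)
exists (1 - (<< ((h t1)^-1)%:C%C *g 0 >> : laurent R[i] r) * g).
exists (1 - h t0 / h t1); split.
- by rewrite subKr; case: idealI => _ _; apply.
- rewrite subr_ge0 ler_pdivrMr // mul1r h_min ?inE //=.
  by rewrite ltrBlDr ltrDl divr_gt0 ?h_gt0.
- move=> t tb; have tt := torus_fibre_pt a t.
  rewrite laurent_evalB laurent_eval1 // laurent_evalM // laurent_evalU.
  rewrite monomial_eval0 // mulr1 gE -rmorphM.
  rewrite -(rmorph1 (real_complex R)) -rmorphB.
  rewrite normcR ger0_norm mulrC; last first.
    by rewrite subr_ge0 ler_pdivrMr // mul1r h_max ?inE.
  by rewrite lerD2l lerN2 ler_pM2r ?invr_gt0 // h_min ?inE.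
Qed.

Lemma exists_superlopsided : ~ amoeba I a ->
  exists2 g, I g & superlopsided (moduli_at g a).
Proof.
move=> /ideal_contraction[u [rho [Iu rho01 u_rho]]].
have [d ud] := exists_laurent_box u.
have [n n_lt1] := polynomial_geometric_lt1 d r rho01.
have /andP[rho0 rho1] := rho01.
(* [S] bounds the number of terms. The factor 2 in [2 * S * e < 1] leaves room for the loss in the
   constant term: since [S >= 1], it gives [S * e < 1 - e]. *)
set S : R := ((n * d).*2.+1 ^ r)%:R in n_lt1.
have S1 : 1 <= S by rewrite ler1n expn_gt0.
set e := rho ^+ n in n_lt1; have e0 : 0 <= e by rewrite exprn_ge0.
have une k : Normc.normc (u ^+ n)@_k * weight a k <= e.
  apply: coeff_le_sup k => t tb.
  rewrite laurent_evalX; last exact: torus_fibre_pt.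
  have normc_ge0 (x : R[i]) : 0 <= Normc.normc x.
    by case: x => x y; exact: sqrtr_ge0.
  have -> x : Normc.normc (x ^+ n) = Normc.normc x ^+ n :> R.
    exact: (normc_exprz x n).
  rewrite lerXn2r ?nnegrE //; apply: u_rho => i.
  by rewrite /= in_itv /= tb.
pose p := 1 - u ^+ n.
have pE k : p@_k = (k == 0)%:R - (u ^+ n)@_k by rewrite mcoeffB laurent_coeff1.
have weight0 : weight a 0 = 1.
  by rewrite /weight big1 // => i _; rewrite mxE expr0z.
have p0 : 1 - e <= Normc.normc p@_0.
  rewrite pE eqxx; have := une 0; rewrite weight0 mulr1 => u0.
  have := le_normcD (1 - (u ^+ n)@_0) (u ^+ n)@_0; rewrite subrK Normc.normc1.
  lra.
have e1 : e < 1 - e by nra.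
have p_supp0 : 0 \in msupp p.
  rewrite -mcoeff_neq0; apply/eqP => p00.
  by move: p0; rewrite p00 Normc.normc0; lra.
(* The added constant has exponent [0], so it does not enlarge the box of [u ^+ n]. *)
have p_box : laurent_in_box (n * d) p.
  move=> k i; rewrite pE; case: (k =P 0) => [->|_]; first by rewrite mxE.
  by rewrite mulr0n sub0r oppr_eq0; exact: laurent_in_boxX.
exists p.
  (* The geometric factorization makes [p] a multiple of [1 - u], which lies in [I]. *)
  have -> : p = (\sum_(i < n) u ^+ i) * (1 - u).
    by rewrite /p -opprB subrX1 -mulNr opprB mulrC.
  by case: idealI => _ _; apply.
apply: (superlopsided_moduli p_supp0) => k kp k0.
rewrite !moduli_weight weight0 mulr1 pE (negPf k0) sub0r normcN.
apply: lt_le_trans p0; apply: le_lt_trans (_ : S * e < _); last by nra.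
apply: le_trans (ler_wpM2l (ler0n _ _) (une k)) _; apply: ler_wpM2r => //.
by rewrite ler_nat (leq_trans (leq_pred _)) // size_msupp_box.
Qed.

End Nullstellensatz.

Theorem theorem2 (R : realType) (r : nat) (I : set (laurent R[i] r))
    (a : 'rV[R]_r) (idealI : is_ideal I) :
  (amoeba I a <-> forall g, I g -> ~~ lopsided (moduli_at g a)) /\
  (amoeba I a <-> forall g, I g -> ~~ superlopsided (moduli_at g a)).
Proof.
have super_lop g : superlopsided (moduli_at g a) -> lopsided (moduli_at g a).
  apply: superlopsided_lopsided => x; apply: term_moduli_gt0.
  exact: torus_real_point.
(* This also settles the lopsided converse: if no list is lopsided, none is superlopsided. *)
have not_super :
    (forall g, I g -> ~~ superlopsided (moduli_at g a)) -> amoeba I a.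
  move=> noI; apply: contrapT => /(exists_superlopsided idealI)[g Ig].
  by apply/negP/noI.
split; split.
- by move=> aI g; exact: amoeba_not_lopsided.
- move=> noI; apply: not_super => g /noI; exact/contra/super_lop.
- move=> aI g Ig; apply: contra (super_lop g) _.
  exact: amoeba_not_lopsided Ig.
- exact: not_super.
Qed.
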